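(* Let $\mathfrak{L}=(V,E,\lambda,\iota)$ be a $\lambda$-graph system over a finite alphabet $\Sigma$ and let $G$ be a finite group. Then $\mathfrak{L}$ is (isomorphic to) a $G$-extension $\mathfrak{L}_\circ^{G,\ell_\circ}$ of some $\lambda$-graph system $\mathfrak{L}_\circ$ over some alphabet $\Sigma_\circ$, for some map $\ell_\circ:\Sigma_\circ\to G$, if and only if there exist an alphabet $\Sigma_\circ$ with $\Sigma=G\times\Sigma_\circ$ (an identification of $\Sigma$ with $G\times\Sigma_\circ$), a free action $\rho$ of $G$ on $\mathfrak{L}$, and maps $\eta_\circ:E\to G$, $r_\circ:E\to\Sigma_\circ$, $\ell_\circ:\Sigma_\circ\to G$ such that (a) $\lambda(e)=(\eta_\circ(e),r_\circ(e))$, $\eta_\circ(\rho^E_g(e))=g\,\eta_\circ(e)$ and $r_\circ(\rho^E_g(e))=r_\circ(e)$ for all $g\in G$, $e\in E$; (b) $\eta_\circ(e)=\eta_\circ(f)\,\ell_\circ(r_\circ(f))$ for all $l\ge 1$, $e\in E_{l,l+1}$, $f\in E_{l-1,l}$ with $t(f)=s(e)$; (c) $\eta_\circ(e)=\eta_\circ(e')$ for all $e,e'\in E_{0,1}$ with $s(e)=s(e')$.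
   Context: $\lambda$-graph systems: a $\lambda$-graph system $\mathfrak{L}=(V,E,\lambda,\iota)$ over $\Sigma$ consists of a vertex set $V=\bigsqcup_{l\ge 0}V_l$ and an edge set $E=\bigsqcup_{l\ge 0}E_{l,l+1}$ with all $V_l,E_{l,l+1}$ finite, source and terminal maps $s:E_{l,l+1}\to V_l$, $t:E_{l,l+1}\to V_{l+1}$, a labeling map $\lambda:E\to\Sigma$ and surjections $\iota=\iota_{l,l+1}:V_{l+1}\to V_l$, such that: every vertex is the source of some edge; every vertex in $V_l$, $l\ge1$, is the terminal of some edge; for $l\ge 1$ and $v\in V_{l+1}$, there is an edge in $E_{l,l+1}$ labeled $\alpha$ with terminal $v$ if and only if there is an edge in $E_{l-1,l}$ labeled $\alpha$ with terminal $\iota(v)$; and (local property) for $l\ge1$, $u\in V_{l-1}$, $v\in V_{l+1}$ there is a label-preserving bijection between $\{e\in E_{l,l+1}: t(e)=v,\ \iota(s(e))=u\}$ and $\{e\in E_{l-1,l}: s(e)=u,\ t(e)=\iota(v)\}$. All $\lambda$-graph systems are assumed left-resolving: $t(e)\ne t(f)$ whenever $e\neq f$ and $\lambda(e)=\lambda(f)$. Isomorphism of $\lambda$-graph systems over $\Sigma$ and $\Sigma'$: bijections $V\to V'$, $E\to E'$ preserving levels, and $\phi:\Sigma\to\Sigma'$, compatible with $s,t,\iota$ and with the labelings (via $\phi$). Extension: given $\mathfrak{L}_\circ=(V_\circ,E_\circ,\lambda_\circ,\iota_\circ)$ over $\Sigma_\circ$ and $\ell_\circ:\Sigma_\circ\to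 G$, the $G$-extension $\mathfrak{L}_\circ^{G,\ell_\circ}$ is the $\lambda$-graph system over $G\times\Sigma_\circ$ with level-$l$ vertices $G\times V_{\circ,l}$, edges $G\times E_{\circ,l,l+1}$, $\iota$-map $(g,v)\mapsto(g,\iota_\circ(v))$, $s(g,e)=(g,s(e))$, $t(g,e)=(g\,\ell_\circ(\lambda_\circ(e)),t(e))$ and label $(g,\lambda_\circ(e))$. Action: an action $\rho$ of $G$ on $\mathfrak{L}$ is a family $\rho_g=(\rho^V_g,\rho^E_g,\rho^\Sigma_g)$, $g\in G$, of bijections $\rho^V_g:V_l\to V_l$, $\rho^E_g:E_{l,l+1}\to E_{l,l+1}$, $\rho^\Sigma_g:\Sigma\to\Sigma$ with $\rho^V_g\circ\iota=\iota\circ\rho^V_g$, $\rho^V_g(s(e))=s(\rho^E_g(e))$, $\rho^V_g(t(e))=t(\rho^E_g(e))$, $\rho^\Sigma_g(\lambda(e))=\lambda(\rho^E_g(e))$, and $\rho^*_1=\mathrm{id}$, $\rho^*_{g}\circ\rho^*_{h}=\rho^*_{gh}$ for $*=V,E,\Sigma$. It is free if for $g\ne1$ the maps $\rho_g^V$ and $\rho^E_g$ have no fixed points. *)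

(* Defs.v *)
From HB Require Import structures.
From mathcomp Require Import all_boot all_fingroup.

Set Implicit Arguments.
Unset Strict Implicit.
Unset Printing Implicit Defensive.

Local Open Scope group_scope.

(* The disjoint unions of the V_l and of the E_{l,l+1} are kept as families
   indexed by the level: [edge L l] is E_{l,l+1}.  A condition on levels l >= 1
   is stated with l.+1 in place of l. *)
Record lambda_graph_system (Sigma : finType) := LambdaGraphSystem {
  vertex : nat -> finType;
  edge : nat -> finType;
  src : forall l, edge l -> vertex l;
  tgt : forall l, edge l -> vertex l.+1;
  lab : forall l, edge l -> Sigma;
  iota_map : forall l, vertex l.+1 -> vertex l;
  iota_surj : forall l (v : vertex l), exists w, iota_map w = v;
  src_surj : forall l (v : vertex l), exists e, src e = v;
  tgt_surj : forall l (v : vertex l.+1), exists e, tgt e = v;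
  lab_iota : forall l (v : vertex l.+2) (a : Sigma),
    (exists e : edge l.+1, lab e = a /\ tgt e = v) <->
    (exists e : edge l, lab e = a /\ tgt e = iota_map v);
  local_property : forall l (u : vertex l) (v : vertex l.+2),
    exists f : {e : edge l.+1 | (tgt e == v) && (iota_map (src e) == u)} ->
               {e : edge l | (src e == u) && (tgt e == iota_map v)},
      bijective f /\ forall e, lab (val (f e)) = lab (val e);
  (* Edges of different levels never share their terminal vertex, so it
     suffices to compare edges of the same level. *)
  left_resolving : forall l (e f : edge l),
    e <> f -> lab e = lab f -> tgt e <> tgt f
}.

Arguments src {Sigma l0 l} _ : rename.
Arguments tgt {Sigma l0 l} _ : rename.
Arguments lab {Sigma l0 l} _ : rename.
Arguments iota_map {Sigma l0 l} _ : rename.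

Definition lgs_isomorphic (Sigma Sigma' : finType)
    (L : lambda_graph_system Sigma) (L' : lambda_graph_system Sigma') : Prop :=
  exists (fV : forall l, vertex L l -> vertex L' l)
         (fE : forall l, edge L l -> edge L' l)
         (phi : Sigma -> Sigma'),
    [/\ (forall l, bijective (fV l)) /\ (forall l, bijective (fE l)) /\
          bijective phi,
        forall l (e : edge L l), src (fE l e) = fV l (src e),
        forall l (e : edge L l), tgt (fE l e) = fV l.+1 (tgt e),
        forall l (v : vertex L l.+1), iota_map (fV l.+1 v) = fV l (iota_map v) &
        forall l (e : edge L l), lab (fE l e) = phi (lab e)].

Section Extension.

Variables (G : finGroupType) (Sigma0 : finType).
Variables (L0 : lambda_graph_system Sigma0) (ell : Sigma0 -> G).

Definition ext_vertex (l : nat) : finType := (G * vertex L0 l)%type.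
Definition ext_edge (l : nat) : finType := (G * edge L0 l)%type.
Definition ext_src l (e : ext_edge l) : ext_vertex l := (e.1, src e.2).
Definition ext_tgt l (e : ext_edge l) : ext_vertex l.+1 :=
  (e.1 * ell (lab e.2), tgt e.2).
Definition ext_lab l (e : ext_edge l) : G * Sigma0 := (e.1, lab e.2).
Definition ext_iota l (v : ext_vertex l.+1) : ext_vertex l :=
  (v.1, iota_map v.2).

Fact ext_iota_surj l (v : ext_vertex l) : exists w, ext_iota w = v.
Proof.
by case: v => g v; have [w <-] := iota_surj v; exists (g, w).
Qed.

Fact ext_src_surj l (v : ext_vertex l) : exists e, ext_src e = v.
Proof.
by case: v => g v; have [e <-] := src_surj v; exists (g, e).
Qed.

Fact ext_tgt_surj l (v : ext_vertex l.+1) : exists e, ext_tgt e = v.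
Proof.
case: v => g v; have [e <-] := tgt_surj v.
by exists (g * (ell (lab e))^-1, e); rewrite /ext_tgt /= mulgKV.
Qed.

Fact ext_lab_iota l (v : ext_vertex l.+2) (a : G * Sigma0) :
  (exists e : ext_edge l.+1, ext_lab e = a /\ ext_tgt e = v) <->
  (exists e : ext_edge l, ext_lab e = a /\ ext_tgt e = ext_iota v).
Proof.
case: v a => h v [k a]; rewrite /ext_lab /ext_tgt /ext_iota /=.
split=> -[[g e] /= [[-> lab_e] [<- tgt_e]]].
  have [|e' [lab_e' tgt_e']] := (lab_iota v a).1; first by exists e.
  by exists (k, e'); rewrite /= lab_e' tgt_e' lab_e.
have [|e' [lab_e' tgt_e']] := (lab_iota v a).2; first by exists e.
by exists (k, e'); rewrite /= lab_e' tgt_e' lab_e.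
Qed.

Fact ext_local_property l (u : ext_vertex l) (v : ext_vertex l.+2) :
  exists f : {e : ext_edge l.+1 | (ext_tgt e == v) &&
                                  (ext_iota (ext_src e) == u)} ->
             {e : ext_edge l | (ext_src e == u) && (ext_tgt e == ext_iota v)},
    bijective f /\ forall e, ext_lab (val (f e)) = ext_lab (val e).
Proof.
case: u v => k u [h v].
have [f [[f' fK f'K] labf]] := local_property u v.
have labf' e : lab (val (f' e)) = lab (val e) by rewrite -labf f'K.
pose A e := (ext_tgt e == (h, v)) && (ext_iota (ext_src e) == (k, u)).
pose B e := (ext_src e == (k, u)) && (ext_tgt e == ext_iota (l := l.+1) (h, v)).
have A0 (x : {e | A e}) :
    (tgt (val x).2 == v) && (iota_map (src (val x).2) == u).
  by case: x => -[g e] /= /andP[/eqP[_ ->] /eqP[_ ->]]; rewrite !eqxx.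
have B0 (x : {e | B e}) :
    (src (val x).2 == u) && (tgt (val x).2 == iota_map v).
  by case: x => -[g e] /= /andP[/eqP[_ ->] /eqP[_ ->]]; rewrite !eqxx.
have AB (x : {e | A e}) : B ((val x).1, val (f (Sub (val x).2 (A0 x)))).
  rewrite /B /ext_src /ext_tgt /ext_iota /= labf /=.
  case/andP: (valP (f (Sub (val x).2 (A0 x)))) => /eqP -> /eqP ->.
  by case: x (A0 x) => -[g e] /= /andP[/eqP[<- _] /eqP[<- _]] _; rewrite !eqxx.
have BA (x : {e | B e}) : A ((val x).1, val (f' (Sub (val x).2 (B0 x)))).
  rewrite /A /ext_src /ext_tgt /ext_iota /= labf' /=.
  case/andP: (valP (f' (Sub (val x).2 (B0 x)))) => /eqP -> /eqP ->.
  by case: x (B0 x) => -[g e] /= /andP[/eqP[<- _] /eqP[<- _]] _; rewrite !eqxx.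
exists (fun x => Sub _ (AB x)); split; last first.
  by move=> x; rewrite /ext_lab /= labf.
exists (fun x => Sub _ (BA x)) => x; apply: val_inj.
  rewrite /=; set y := (X in f' X).
  have -> : y = f (Sub (val x).2 (A0 x)) by apply: val_inj.
  by rewrite fK /=; case: (val x).
rewrite /=; set y := (X in f X).
have -> : y = f' (Sub (val x).2 (B0 x)) by apply: val_inj.
by rewrite f'K /=; case: (val x).
Qed.

Fact ext_left_resolving l (e f : ext_edge l) :
  e <> f -> ext_lab e = ext_lab f -> ext_tgt e <> ext_tgt f.
Proof.
case: e f => g e [h f] ne_ef [/= gh lab_ef] [_ tgt_ef].
by apply: (left_resolving _ lab_ef tgt_ef) => ef; apply: ne_ef; rewrite gh ef.
Qed.

Definition G_extension : lambda_graph_system (G * Sigma0)%type :=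
  LambdaGraphSystem ext_iota_surj ext_src_surj ext_tgt_surj ext_lab_iota
    ext_local_property ext_left_resolving.

End Extension.

Record lgs_action (G : finGroupType) (Sigma : finType)
    (L : lambda_graph_system Sigma) := LgsAction {
  actV : G -> forall l, vertex L l -> vertex L l;
  actE : G -> forall l, edge L l -> edge L l;
  actS : G -> Sigma -> Sigma;
  actV_bij : forall g l, bijective (actV g (l := l));
  actE_bij : forall g l, bijective (actE g (l := l));
  actS_bij : forall g, bijective (actS g);
  actV_iota : forall g l (v : vertex L l.+1),
    actV g (iota_map v) = iota_map (actV g v);
  act_src : forall g l (e : edge L l), actV g (src e) = src (actE g e);
  act_tgt : forall g l (e : edge L l), actV g (tgt e) = tgt (actE g e);
  act_lab : forall g l (e : edge L l), actS g (lab e) = lab (actE g e);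
  actV1 : forall l (v : vertex L l), actV 1 v = v;
  actE1 : forall l (e : edge L l), actE 1 e = e;
  actS1 : forall a, actS 1 a = a;
  actVM : forall g h l (v : vertex L l), actV g (actV h v) = actV (g * h) v;
  actEM : forall g h l (e : edge L l), actE g (actE h e) = actE (g * h) e;
  actSM : forall g h a, actS g (actS h a) = actS (g * h) a
}.

Definition free_action (G : finGroupType) (Sigma : finType)
    (L : lambda_graph_system Sigma) (rho : lgs_action G L) : Prop :=
  forall g : G, g <> 1 ->
    (forall l (v : vertex L l), actV rho g v <> v) /\
    (forall l (e : edge L l), actE rho g e <> e).

(* Main.v *)
Require Import Defs.
From HB Require Import structures.
From mathcomp Require Import all_boot all_fingroup.

Set Implicit Arguments.
Unset Strict Implicit.
Unset Printing Implicit Defensive.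

(** An isomorphism with an extension transports the left translation action of
    [G].  Conversely, by (b) and (c) the value [eta e] depends only on the
    source of [e], so [eta] descends to an equivariant map on vertices, and the
    local property makes that map invariant under iota.  The vertices and edges
    on which [eta] is trivial thus form a transversal of the orbits of [G]; with
    terminal vertices translated back into the transversal they are the required
    system, and [x |-> (eta x, (eta x)^-1 x)] is the isomorphism. *)

Local Open Scope group_scope.

(* [bijective] only asserts a two-sided inverse in [Prop]; finiteness makes it
   available as data, which the components of an action require. *)
Lemma bij_inv (S T : finType) (f : S -> T) :
  bijective f -> {f' | cancel f f' /\ cancel f' f}.
Proof.
move=> bij_f; have f_onto y : exists x, f x == y.
  by have [f' _ f'K] := bij_f; exists (f' y); rewrite f'K.
have f'K : cancel (fun y => xchoose (f_onto y)) f.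
  by move=> y; apply/eqP; apply: (xchooseP (f_onto y)).
exists (fun y => xchoose (f_onto y)); split=> // x.
by apply: (bij_inj bij_f); rewrite f'K.
Qed.

(** * Left translation on [G * T] and its transport along a bijection *)

Section Translation.

Variable G : finGroupType.

Definition translate (T : Type) (g : G) (x : G * T) : G * T := (g * x.1, x.2).

Lemma translate1 (T : Type) (x : G * T) : translate 1 x = x.
Proof. by case: x => h x; rewrite /translate mul1g. Qed.

Lemma translateM (T : Type) g h (x : G * T) :
  translate g (translate h x) = translate (g * h) x.
Proof. by rewrite /translate mulgA. Qed.

(** Left translation by [g] pulled back along [f], with [f'] standing for the inverse of [f]. *)
Definition conj_translate (S T : Type) (f : S -> G * T) f' (g : G) (x : S) : S :=
  f' (translate g (f x)).

Section Cancel.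

Variables (S T : Type) (f : S -> G * T) (f' : G * T -> S).
Hypotheses (fK : cancel f f') (f'K : cancel f' f).

Lemma conj_translateE g x : f (conj_translate f f' g x) = translate g (f x).
Proof. by rewrite f'K. Qed.

Lemma conj_translate1 x : conj_translate f f' 1 x = x.
Proof. by rewrite /conj_translate translate1 fK. Qed.

Lemma conj_translateM g h x :
  conj_translate f f' g (conj_translate f f' h x) = conj_translate f f' (g * h) x.
Proof. by rewrite /conj_translate f'K translateM. Qed.

Lemma conj_translate_bij g : bijective (conj_translate f f' g).
Proof.
exists (conj_translate f f' g^-1) => x.
  by rewrite conj_translateM mulVg conj_translate1.
by rewrite conj_translateM mulgV conj_translate1.
Qed.

Lemma conj_translate_free g x : g <> 1 -> conj_translate f f' g x <> x.
Proof.
move=> g_neq1 /(congr1 f); rewrite conj_translateE.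
by case: (f x) => h y [/(canRL (mulgK h))]; rewrite mulgV.
Qed.

End Cancel.

End Translation.

(** * From an extension to a free action *)

Section ExtensionAction.

Variables (Sigma Sigma0 : finType) (G : finGroupType).
Variables (L : lambda_graph_system Sigma) (L0 : lambda_graph_system Sigma0).
Variable ell : Sigma0 -> G.

(** In the extension the label of an edge carries its [G]-coordinate, which is also that of its
    source. Hence (c), and (b) follows since terminals multiply that coordinate by [ell] of the
    label. *)
Lemma extension_action : lgs_isomorphic L (G_extension L0 ell) ->
  exists (psi : Sigma -> G * Sigma0) (rho : lgs_action G L)
         (eta : forall l, edge L l -> G) (r : forall l, edge L l -> Sigma0),
    [/\ bijective psi,
        free_action rho,
        [/\ forall l (e : edge L l), psi (lab e) = (eta l e, r l e),
            forall (g : G) l (e : edge L l), eta l (actE rho g e) = g * eta l e &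
            forall (g : G) l (e : edge L l), r l (actE rho g e) = r l e],
        forall l (e : edge L l.+1) (f : edge L l),
          tgt f = src e -> eta l.+1 e = eta l f * ell (r l f) &
        forall e e' : edge L 0, src e = src e' -> eta 0 e = eta 0 e'].
Proof.
case=> fV [fE [phi [[bijV [bijE bijS]] f_src f_tgt f_iota f_lab]]].
pose fV' l := sval (bij_inv (bijV l)).
pose fE' l := sval (bij_inv (bijE l)).
pose phi' := sval (bij_inv bijS).
have fVK l : cancel (fV l) (fV' l) := (svalP (bij_inv (bijV l))).1.
have fV'K l : cancel (fV' l) (fV l) := (svalP (bij_inv (bijV l))).2.
have fEK l : cancel (fE l) (fE' l) := (svalP (bij_inv (bijE l))).1.
have fE'K l : cancel (fE' l) (fE l) := (svalP (bij_inv (bijE l))).2.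
have phiK : cancel phi phi' := (svalP (bij_inv bijS)).1.
have phi'K : cancel phi' phi := (svalP (bij_inv bijS)).2.
pose aV g l : vertex L l -> vertex L l := conj_translate (fV l) (fV' l) g.
pose aE g l : edge L l -> edge L l := conj_translate (fE l) (fE' l) g.
pose aS g : Sigma -> Sigma := conj_translate phi phi' g.
have aV_E g l v : fV l (aV g l v) = translate g (fV l v).
  exact: conj_translateE.
have aE_E g l e : fE l (aE g l e) = translate g (fE l e).
  exact: conj_translateE.
have aS_E g a : phi (aS g a) = translate g (phi a) by apply: conj_translateE.
(* Each compatibility is checked in the extension, after applying the injective [fV] or [phi]. *)
have a_iota g l (v : vertex L l.+1) :
    aV g l (iota_map v) = iota_map (aV g l.+1 v).
  by apply: (can_inj (fVK l)); rewrite aV_E -!f_iota aV_E.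
have a_src g l (e : edge L l) : aV g l (src e) = src (aE g l e).
  by apply: (can_inj (fVK l)); rewrite aV_E -!f_src aE_E.
(* Left translation by [g] commutes with the right multiplication by [ell] in [ext_tgt]. *)
have a_tgt g l (e : edge L l) : aV g l.+1 (tgt e) = tgt (aE g l e).
  apply: (can_inj (fVK l.+1)); rewrite aV_E -!f_tgt aE_E.
  by rewrite /= /ext_tgt /translate /= mulgA.
have a_lab g l (e : edge L l) : aS g (lab e) = lab (aE g l e).
  by apply: (can_inj phiK); rewrite aS_E -!f_lab aE_E.
pose rho := @LgsAction G Sigma L aV aE aS
  (fun g l => conj_translate_bij (fVK l) (fV'K l) g)
  (fun g l => conj_translate_bij (fEK l) (fE'K l) g)
  (fun g => conj_translate_bij phiK phi'K g)
  a_iota a_src a_tgt a_lab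
  (fun l => conj_translate1 (fVK l)) (fun l => conj_translate1 (fEK l))
  (conj_translate1 phiK)
  (fun g h l => conj_translateM (fV'K l) g h)
  (fun g h l => conj_translateM (fE'K l) g h)
  (conj_translateM phi'K).
exists phi, rho, (fun l e => (fE l e).1), (fun l e => lab (fE l e).2).
split=> //.
- move=> g g_neq1; split=> l x.
    exact: (conj_translate_free (fV'K l)).
  exact: (conj_translate_free (fE'K l)).
- split=> [l e | g l e | g l e]; first by rewrite -f_lab.
    by rewrite [fE l _]aE_E.
  by rewrite [fE l _]aE_E.
(* For (b) and (c), compare the [G]-coordinates of the images of the two equal vertices. *)
- by move=> l e f /(congr1 (fV l.+1)); rewrite -f_tgt -f_src => -[<-].
- by move=> e e' /(congr1 (fV 0)); rewrite -!f_src => -[<-].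
Qed.

End ExtensionAction.

(** Injective labels name the elements, so matching equal labels is the bijection. The local
    property then reduces to an equality of label sets. *)
Lemma label_bijection (A B : finType) (S : eqType) (la : A -> S) (lb : B -> S) :
    injective la -> injective lb ->
    (forall s, (exists a, la a = s) <-> (exists b, lb b = s)) ->
  exists f : A -> B, bijective f /\ forall a, lb (f a) = la a.
Proof.
move=> la_inj lb_inj la_lb.
have AB a : exists b, lb b == la a.
  by have [|b <-] := (la_lb (la a)).1; [exists a | exists b].
have BA b : exists a, la a == lb b.
  by have [|a <-] := (la_lb (lb b)).2; [exists b | exists a].
have AB_lab a : lb (xchoose (AB a)) = la a by apply/eqP/(xchooseP (AB a)).
have BA_lab b : la (xchoose (BA b)) = lb b by apply/eqP/(xchooseP (BA b)).
exists (fun a => xchoose (AB a)); split=> //.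
exists (fun b => xchoose (BA b)) => x.
  by apply: la_inj; rewrite BA_lab AB_lab.
by apply: lb_inj; rewrite AB_lab BA_lab.
Qed.

(** * From an action with (a), (b), (c) to an extension *)

Section Transversal.

Variables (Sigma Sigma0 : finType) (G : finGroupType).
Variables (L : lambda_graph_system Sigma) (psi : Sigma -> G * Sigma0).
Variables (rho : lgs_action G L).
Variables (eta : forall l, edge L l -> G) (r : forall l, edge L l -> Sigma0).
Variable ell : Sigma0 -> G.

Hypothesis psi_bij : bijective psi.
Hypothesis psi_lab : forall l (e : edge L l), psi (lab e) = (eta e, r e).
Hypothesis eta_act :
  forall g l (e : edge L l), eta (actE rho g e) = g * eta e.
Hypothesis r_act : forall g l (e : edge L l), r (actE rho g e) = r e.
Hypothesis eta_step : forall l (e : edge L l.+1) (f : edge L l),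
  tgt f = src e -> eta e = eta f * ell (r f).
Hypothesis eta_init :
  forall e e' : edge L 0, src e = src e' -> eta e = eta e'.

(** At level 0 this is (c). Above, any edge into the common source determines both values through
    (b). *)
Lemma eta_src_eq l (e e' : edge L l) : src e = src e' -> eta e = eta e'.
Proof.
case: l e e' => [|l] e e'; first exact: eta_init.
have [f tgt_f] := tgt_surj (src e) => src_e.
by rewrite (eta_step tgt_f) (@eta_step _ e' f) // tgt_f.
Qed.

Lemma out_edge l (v : vertex L l) : exists e : edge L l, src e == v.
Proof. by have [e <-] := src_surj v; exists e. Qed.

(** The choice of outgoing edge is immaterial by [eta_src_eq]. *)
Definition etaV l (v : vertex L l) : G := eta (xchoose (out_edge v)).

Lemma etaV_src l (e : edge L l) : etaV (src e) = eta e.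
Proof. by apply: eta_src_eq; apply/eqP; apply: xchooseP (out_edge _). Qed.

Lemma etaV_tgt l (e : edge L l) : etaV (tgt e) = eta e * ell (r e).
Proof.
by have [f src_f] := src_surj (tgt e); rewrite -src_f etaV_src; apply: eta_step.
Qed.

Lemma etaV_act g l (v : vertex L l) : etaV (actV rho g v) = g * etaV v.
Proof.
by have [e <-] := src_surj v; rewrite act_src !etaV_src eta_act.
Qed.

Lemma lab_eqP l m (e : edge L l) (f : edge L m) :
  lab e = lab f <-> eta e = eta f /\ r e = r f.
Proof.
split=> [/(congr1 psi)|[eta_ef r_ef]]; first by rewrite !psi_lab => -[].
by apply: (bij_inj psi_bij); rewrite !psi_lab eta_ef r_ef.
Qed.

(** The local property reduced to existence of labeled edges, the form that passes to the
    transversal; [label_bijection] later restores the bijection. *)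
Lemma local_lab l (u : vertex L l) (v : vertex L l.+2) (a : Sigma) :
  (exists e : edge L l.+1, [/\ lab e = a, tgt e = v & iota_map (src e) = u]) <->
  (exists e : edge L l, [/\ lab e = a, src e = u & tgt e = iota_map v]).
Proof.
have [f [[f' fK f'K] lab_f]] := local_property u v; split=> [] [e []].
  move=> lab_e tgt_e iota_e.
  have e_in : (tgt e == v) && (iota_map (src e) == u).
    by rewrite tgt_e iota_e !eqxx.
  exists (val (f (Sub e e_in))); rewrite lab_f.
  by case/andP: (valP (f (Sub e e_in))) => /eqP-> /eqP->.
move=> lab_e src_e tgt_e.
have e_in : (src e == u) && (tgt e == iota_map v).
  by rewrite src_e tgt_e !eqxx.
exists (val (f' (Sub e e_in))); rewrite -lab_f f'K.
by case/andP: (valP (f' (Sub e e_in))) => /eqP-> /eqP->.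
Qed.

(** The local property matches an edge out of [v] with an edge out of [iota_map v] of the same
    label, hence of the same [eta]. *)
Lemma etaV_iota l (v : vertex L l.+1) : etaV (iota_map v) = etaV v.
Proof.
have [e src_e] := src_surj v.
have [|e' [/lab_eqP[eta_e' _] src_e' _]] :=
    (local_lab (iota_map v) (tgt e) (lab e)).1; first by exists e; rewrite src_e.
by rewrite -src_e' -src_e !etaV_src.
Qed.

(** The one point of the orbit of [v] where [etaV] is trivial. *)
Definition nrmV l (v : vertex L l) := actV rho (etaV v)^-1 v.
Definition nrmE l (e : edge L l) := actE rho (eta e)^-1 e.

Lemma etaV_nrm l (v : vertex L l) : etaV (nrmV v) = 1.
Proof. by rewrite etaV_act mulVg. Qed.

Lemma eta_nrm l (e : edge L l) : eta (nrmE e) = 1.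
Proof. by rewrite eta_act mulVg. Qed.

Lemma nrmV_act g l (v : vertex L l) : nrmV (actV rho g v) = nrmV v.
Proof. by rewrite /nrmV etaV_act actVM invMg mulgKV. Qed.

Lemma nrmE_act g l (e : edge L l) : nrmE (actE rho g e) = nrmE e.
Proof. by rewrite /nrmE eta_act actEM invMg mulgKV. Qed.

Lemma nrmV_id l (v : vertex L l) : etaV v = 1 -> nrmV v = v.
Proof. by rewrite /nrmV => ->; rewrite invg1 actV1. Qed.

Lemma nrmE_id l (e : edge L l) : eta e = 1 -> nrmE e = e.
Proof. by rewrite /nrmE => ->; rewrite invg1 actE1. Qed.

Lemma nrmVK l (v : vertex L l) : actV rho (etaV v) (nrmV v) = v.
Proof. by rewrite actVM mulgV actV1. Qed.

Lemma nrmEK l (e : edge L l) : actE rho (eta e) (nrmE e) = e.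
Proof. by rewrite actEM mulgV actE1. Qed.

(** Since [eta e = 1], the terminal of [e] has [etaV] equal to [ell (r e)], so normalising it undoes
    exactly that translation. *)
Lemma nrmV_tgt_eq l (e : edge L l) (v : vertex L l.+1) :
    eta e = 1 -> etaV v = 1 ->
  nrmV (tgt e) = v <-> tgt e = actV rho (ell (r e)) v.
Proof.
move=> eta_e etaV_v; split=> [<-|->]; last by rewrite nrmV_act nrmV_id.
by rewrite -[LHS]nrmVK etaV_tgt eta_e mul1g.
Qed.

(** * The transversal as a $\lambda$-graph system *)

Definition tr_vertex l : finType := {v : vertex L l | etaV v == 1}.
Definition tr_edge l : finType := {e : edge L l | eta e == 1}.

Lemma etaV_tr l (v : tr_vertex l) : etaV (val v) = 1.
Proof. exact/eqP/(valP v). Qed.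

Lemma eta_tr l (e : tr_edge l) : eta (val e) = 1.
Proof. exact/eqP/(valP e). Qed.

Lemma to_trV_subproof l (v : vertex L l) : etaV (nrmV v) == 1.
Proof. by rewrite etaV_nrm. Qed.

Lemma to_trE_subproof l (e : edge L l) : eta (nrmE e) == 1.
Proof. by rewrite eta_nrm. Qed.

Definition to_trV l (v : vertex L l) : tr_vertex l :=
  exist (fun w => etaV w == 1) (nrmV v) (to_trV_subproof v).
Definition to_trE l (e : edge L l) : tr_edge l :=
  exist (fun f => eta f == 1) (nrmE e) (to_trE_subproof e).

Lemma to_trV_val l (v : tr_vertex l) : to_trV (val v) = v.
Proof. by apply: val_inj; rewrite /= nrmV_id ?etaV_tr. Qed.

Lemma to_trE_val l (e : tr_edge l) : to_trE (val e) = e.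
Proof. by apply: val_inj; rewrite /= nrmE_id ?eta_tr. Qed.

Lemma to_trV_act g l (v : vertex L l) : to_trV (actV rho g v) = to_trV v.
Proof. by apply: val_inj; rewrite /= nrmV_act. Qed.

Lemma to_trE_act g l (e : edge L l) : to_trE (actE rho g e) = to_trE e.
Proof. by apply: val_inj; rewrite /= nrmE_act. Qed.

(** Only [tr_tgt] may really move a vertex: sources and iota-images already lie in the transversal,
    by [val_tr_src] and [val_tr_iota]. *)
Definition tr_src l (e : tr_edge l) : tr_vertex l := to_trV (src (val e)).
Definition tr_tgt l (e : tr_edge l) : tr_vertex l.+1 := to_trV (tgt (val e)).
Definition tr_lab l (e : tr_edge l) : Sigma0 := r (val e).
Definition tr_iota l (v : tr_vertex l.+1) : tr_vertex l :=
  to_trV (iota_map (val v)).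

Lemma val_tr_src l (e : tr_edge l) : val (tr_src e) = src (val e).
Proof. by rewrite /= nrmV_id // etaV_src eta_tr. Qed.

Lemma val_tr_iota l (v : tr_vertex l.+1) : val (tr_iota v) = iota_map (val v).
Proof. by rewrite /= nrmV_id // etaV_iota etaV_tr. Qed.

Lemma tr_tgt_eq l (e : tr_edge l) (v : tr_vertex l.+1) :
  tr_tgt e = v <-> tgt (val e) = actV rho (ell (tr_lab e)) (val v).
Proof.
have tgt_eq := nrmV_tgt_eq (eta_tr e) (etaV_tr v).
split=> [eq_v | /tgt_eq.2 eq_v]; last exact: val_inj.
by apply: tgt_eq.1; rewrite -eq_v.
Qed.

Lemma tr_iota_surj l (v : tr_vertex l) : exists w, tr_iota w = v.
Proof.
have [w iota_w] := iota_surj (val v); exists (to_trV w).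
apply: val_inj; rewrite val_tr_iota /= -actV_iota iota_w.
by rewrite -etaV_iota iota_w etaV_tr invg1 actV1.
Qed.

Lemma tr_src_surj l (v : tr_vertex l) : exists e, tr_src e = v.
Proof.
have [e src_e] := src_surj (val v); exists (to_trE e).
by rewrite /tr_src /= -act_src to_trV_act src_e to_trV_val.
Qed.

Lemma tr_tgt_surj l (v : tr_vertex l.+1) : exists e, tr_tgt e = v.
Proof.
have [e tgt_e] := tgt_surj (val v); exists (to_trE e).
by rewrite /tr_tgt /= -act_tgt to_trV_act tgt_e to_trV_val.
Qed.

(* A label determines [eta] and [r], so an edge of [L] carrying the label of an
   edge of the transversal is itself in the transversal. *)
Lemma tr_edge_lab l m (e : tr_edge l) (f : edge L m) :
  lab f = lab (val e) -> exists2 f' : tr_edge m, val f' = f & tr_lab f' = tr_lab e.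
Proof.
case/lab_eqP=> eta_f r_f; have f_in : eta f == 1 by rewrite eta_f eta_tr.
by exists (exist _ f f_in).
Qed.

(** The translation relating [tr_tgt] to [tgt] depends only on the label, so it is the same for both
    edges. The axiom of [L] thus applies at the translate of [v] by [ell a]. *)
Lemma tr_lab_iota l (v : tr_vertex l.+2) (a : Sigma0) :
  (exists e : tr_edge l.+1, tr_lab e = a /\ tr_tgt e = v) <->
  (exists e : tr_edge l, tr_lab e = a /\ tr_tgt e = tr_iota v).
Proof.
split=> -[e [<- /tr_tgt_eq tgt_e]].
  have [|f [lab_f tgt_f]] := (lab_iota (actV rho (ell (tr_lab e)) (val v))
    (lab (val e))).1; first by exists (val e).
  have [f' val_f lab_f'] := tr_edge_lab lab_f; exists f'; split=> //.
  by apply/tr_tgt_eq; rewrite val_f lab_f' val_tr_iota actV_iota.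
have [|f [lab_f tgt_f]] := (lab_iota (actV rho (ell (tr_lab e)) (val v))
  (lab (val e))).2.
  by exists (val e); rewrite -actV_iota -val_tr_iota.
have [f' val_f lab_f'] := tr_edge_lab lab_f; exists f'; split=> //.
by apply/tr_tgt_eq; rewrite val_f lab_f'.
Qed.

(** With [eta] trivial on both edges, equal [r] means equal labels in [L]; the terminals are then
    translated by the same element, so they agree in [L] as well. *)
Lemma tr_left_resolving l (e f : tr_edge l) :
  e <> f -> tr_lab e = tr_lab f -> tr_tgt e <> tr_tgt f.
Proof.
move=> ne_ef lab_ef /tr_tgt_eq tgt_e.
have /tr_tgt_eq tgt_f : tr_tgt f = tr_tgt f by [].
apply: (@left_resolving _ _ _ (val e) (val f)).
- by move/val_inj.
- by apply/lab_eqP; rewrite !eta_tr.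
- by rewrite tgt_e tgt_f lab_ef.
Qed.

(** As for [tr_lab_iota], use [local_lab] at the translate of [v] by [ell a]; the vertex [u] stays
    in place. *)
Lemma tr_local_lab l (u : tr_vertex l) (v : tr_vertex l.+2) (a : Sigma0) :
  (exists e : tr_edge l.+1, [/\ tr_lab e = a, tr_tgt e = v &
                                tr_iota (tr_src e) = u]) <->
  (exists e : tr_edge l, [/\ tr_lab e = a, tr_src e = u & tr_tgt e = tr_iota v]).
Proof.
split=> -[e [<-]].
  move=> /tr_tgt_eq tgt_e /(congr1 val); rewrite val_tr_iota val_tr_src => iota_e.
  have [|f [lab_f src_f tgt_f]] := (local_lab (val u)
    (actV rho (ell (tr_lab e)) (val v)) (lab (val e))).1; first by exists (val e).
  have [f' val_f lab_f'] := tr_edge_lab lab_f; exists f'; split=> //.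
    by apply: val_inj; rewrite val_tr_src val_f.
  by apply/tr_tgt_eq; rewrite val_f lab_f' val_tr_iota actV_iota.
move=> /(congr1 val); rewrite val_tr_src => src_e /tr_tgt_eq tgt_e.
have [|f [lab_f tgt_f iota_f]] := (local_lab (val u)
  (actV rho (ell (tr_lab e)) (val v)) (lab (val e))).2.
  by exists (val e); rewrite -actV_iota -val_tr_iota.
have [f' val_f lab_f'] := tr_edge_lab lab_f; exists f'; split=> //.
  by apply/tr_tgt_eq; rewrite val_f lab_f'.
by apply: val_inj; rewrite val_tr_iota val_tr_src val_f.
Qed.

Lemma tr_local_property l (u : tr_vertex l) (v : tr_vertex l.+2) :
  exists f : {e : tr_edge l.+1 | (tr_tgt e == v) && (tr_iota (tr_src e) == u)} ->
             {e : tr_edge l | (tr_src e == u) && (tr_tgt e == tr_iota v)},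
    bijective f /\ forall e, tr_lab (val (f e)) = tr_lab (val e).
Proof.
have tr_lab_inj m (e f : tr_edge m) :
    tr_tgt e = tr_tgt f -> tr_lab e = tr_lab f -> e = f.
  move=> tgt_ef lab_ef; apply/eqP/idPn=> /eqP ne_ef.
  by case: (tr_left_resolving ne_ef).
apply: (label_bijection (la := fun e => tr_lab (val e))
                        (lb := fun e => tr_lab (val e))).
(* Edges on the left all end at [v], those on the right at [tr_iota v], so left-resolving makes
   labels injective on each side. *)
- move=> e f lab_ef; apply/val_inj/tr_lab_inj => //.
  by have [/andP[/eqP-> _] /andP[/eqP-> _]] := (valP e, valP f).
- move=> e f lab_ef; apply/val_inj/tr_lab_inj => //.
  by have [/andP[_ /eqP->] /andP[_ /eqP->]] := (valP e, valP f).
move=> a; split=> -[[e /= e_in] lab_e]; case/andP: (e_in) => /eqP e1 /eqP e2.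
  have [|f [lab_f /eqP f1 /eqP f2]] := (tr_local_lab u v a).1; first by exists e.
  have f_in : (tr_src f == u) && (tr_tgt f == tr_iota v) by rewrite f1.
  by exists (exist _ f f_in).
have [|f [lab_f /eqP f1 /eqP f2]] := (tr_local_lab u v a).2; first by exists e.
have f_in : (tr_tgt f == v) && (tr_iota (tr_src f) == u) by rewrite f1.
by exists (exist _ f f_in).
Qed.

Definition transversal : lambda_graph_system Sigma0 :=
  LambdaGraphSystem tr_iota_surj tr_src_surj tr_tgt_surj tr_lab_iota
    tr_local_property tr_left_resolving.

(** * The isomorphism with the extension *)

Lemma transversal_extension : lgs_isomorphic L (G_extension transversal ell).
Proof.
exists (fun l (v : vertex L l) => (etaV v, to_trV v) : ext_vertex G transversal l).
exists (fun l (e : edge L l) => (eta e, to_trE e) : ext_edge G transversal l).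
exists psi; split.
- split; last split=> // l; first move=> l.
    (* The inverse sends [(g, w)] to the translate of [w] by [g]; on edges likewise. *)
    exists (fun x => actV rho x.1 (val x.2)) => [v | [g v]] /=; first exact: nrmVK.
    by rewrite etaV_act to_trV_act to_trV_val etaV_tr mulg1.
  exists (fun x => actE rho x.1 (val x.2)) => [e | [g e]] /=; first exact: nrmEK.
  by rewrite eta_act to_trE_act to_trE_val eta_tr mulg1.
- move=> l e; rewrite /= /ext_src /= /tr_src /=.
  by rewrite -act_src to_trV_act etaV_src.
- move=> l e; rewrite /= /ext_tgt /= /tr_tgt /tr_lab /=.
  by rewrite -act_tgt to_trV_act r_act etaV_tgt.
- move=> l v; rewrite /= /ext_iota /= /tr_iota /=.
  by rewrite -actV_iota to_trV_act etaV_iota.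
- by move=> l e; rewrite /= /ext_lab /= /tr_lab /= r_act psi_lab.
Qed.

End Transversal.

Theorem theorem4p3 (Sigma : finType) (L : lambda_graph_system Sigma)
    (G : finGroupType) :
  (exists (Sigma0 : finType) (L0 : lambda_graph_system Sigma0)
          (ell : Sigma0 -> G),
     lgs_isomorphic L (G_extension L0 ell))
  <->
  (exists (Sigma0 : finType) (psi : Sigma -> G * Sigma0)
          (rho : lgs_action G L)
          (eta : forall l, edge L l -> G) (r : forall l, edge L l -> Sigma0)
          (ell : Sigma0 -> G),
     [/\ bijective psi,
         free_action rho,
         [/\ forall l (e : edge L l), psi (lab e) = (eta l e, r l e),
             forall (g : G) l (e : edge L l),
               eta l (actE rho g e) = (g * eta l e)%g &
             forall (g : G) l (e : edge L l), r l (actE rho g e) = r l e],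
         forall l (e : edge L l.+1) (f : edge L l),
           tgt f = src e -> eta l.+1 e = (eta l f * ell (r l f))%g &
         forall e e' : edge L 0, src e = src e' -> eta 0 e = eta 0 e']).
Proof.
split=> [[Sigma0 [L0 [ell /extension_action[psi [rho [eta [r hyps]]]]]]] |].
  by exists Sigma0, psi, rho, eta, r, ell.
case=> Sigma0 [psi [rho [eta [r [ell]]]]].
case=> psi_bij _ [psi_lab eta_act r_act] eta_step eta_init.
exists Sigma0, (transversal psi_bij psi_lab eta_act eta_step eta_init), ell.
exact: transversal_extension.
Qed.
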